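(* Let $n\ge 2$ and let $D$ be a loopless multigraph on the vertex set of $K_{n,n}$. If $D$ has at most $2n-3$ edges (counted with multiplicity) and $\Delta(D)\le n$, then $D$ is realizable in $K_{n,n}$.
   Context: $K_{n,n}$ is the complete bipartite graph with color classes $A=\{a_1,\dots,a_n\}$ and $B=\{b_1,\dots,b_n\}$. Given a simple graph $G$ and a loopless multigraph $D$ on the same vertex set, $D$ is realizable in $G$ if one can choose, for every edge $e\in E(D)$ (counted with multiplicity), a path $P(e)$ in $G$ joining the end-vertices of $e$, such that these paths are pairwise edge-disjoint. $\Delta(D)$ is the maximum degree of $D$ counting multiplicities. *)

(* Defs.v *)
From mathcomp Require Import all_boot.

Set Implicit Arguments.
Unset Strict Implicit.
Unset Printing Implicit Defensive.

Record sgraph (V : finType) := SGraph {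
  adj :> rel V;
  adj_sym : symmetric adj;
  adj_irr : irreflexive adj }.

(* Parallel edges are distinct elements of [edge] with the same ends, so that *)
(* [#|edge D|] counts edges with multiplicity; [edge_ends] excludes loops.    *)
Record multigraph (V : finType) := MultiGraph {
  edge : finType;
  ends : edge -> {set V};
  edge_ends : forall e : edge, #|ends e| = 2 }.

Section Realizability.

Variable V : finType.

Definition degree (D : multigraph V) (v : V) : nat :=
  #|[set e : edge D | v \in ends e]|.

Definition max_degree (D : multigraph V) : nat := \max_(v : V) degree D v.

(* A walk is given by its first vertex and the sequence of the later ones. *)
Definition is_path (G : sgraph V) (w : V * seq V) : bool :=
  path G w.1 w.2 && uniq (w.1 :: w.2).

Definition walk_ends (w : V * seq V) : {set V} := [set w.1; last w.1 w.2].

Definition walk_edges (w : V * seq V) : seq {set V} :=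
  pairmap (fun u v => [set u; v]) w.1 w.2.

Definition realizable (G : sgraph V) (D : multigraph V) : Prop :=
  exists P : edge D -> V * seq V,
    (forall e, is_path G (P e) /\ walk_ends (P e) = ends e) /\
    (forall e f, e != f -> [disjoint walk_edges (P e) & walk_edges (P f)]).

End Realizability.

Section CompleteBipartite.

Variable n : nat.

(* [inl i] is a_(i+1) and [inr j] is b_(j+1). *)
Definition Knn_adj : rel ('I_n + 'I_n)%type := fun u v =>
  match u, v with
  | inl _, inr _ | inr _, inl _ => true
  | _, _ => false
  end.

Lemma Knn_adj_sym : symmetric Knn_adj.
Proof. by case=> [i|i] [j|j]. Qed.

Lemma Knn_adj_irr : irreflexive Knn_adj.
Proof. by case. Qed.

Definition Knn : sgraph ('I_n + 'I_n)%type := SGraph Knn_adj_sym Knn_adj_irr.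

End CompleteBipartite.

(* Main.v *)
Require Import Defs.
From mathcomp Require Import all_boot zify.

Set Implicit Arguments.
Unset Strict Implicit.
Unset Printing Implicit Defensive.

(* Vertices are removed one at a time from complete bipartite graphs whose    *)
(* sides A and B differ in size by at most one, keeping at most |A| + |B| - 3 *)
(* demands and at each vertex at most as many demands as it has neighbours.   *)
(* To remove a from A, the star of a is used up: a demand {a, b} with b in B  *)
(* is met by the edge ab, the other demands at a are handed over to distinct  *)
(* vertices of B, and each vertex of B of full degree passes one of its       *)
(* demands through a on to another vertex of B.  Counting the demands shows   *)
(* that the star has room for this, whatever a is.                            *)
(*   The number of demands must drop by one as well, which is automatic if    *)
(* some demand joins A to B; if none does but some demand lies inside B, then *)
(* a vertex a of minimal degree has room to meet one of these.  There remains *)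
(* the case |A| = |B| + 1 with all demands inside A.  If two of them are      *)
(* parallel, their common ends are removed one after the other; otherwise     *)
(* some b in B meets two disjoint demands that cover all vertices of full     *)
(* degree.                                                                    *)

(* Hypotheses about sets slow [lia] down by orders of magnitude. *)
Ltac nat_lia :=
  repeat match goal with
  | H : ?T |- _ => lazymatch T with
      | is_true (leq _ _) => fail
      | @eq nat _ _ => fail
      | _ => clear H
      end
  end; lia.

Section FiniteSets.

Variable V : finType.
Implicit Types (u v x y : V) (A B X : {set V}).

Lemma set2_inj u v x y :
  [set u; v] = [set x; y] -> (u = x /\ v = y) \/ (u = y /\ v = x).
Proof.
move=> Exy; have /set2P ux : u \in [set x; y] by rewrite -Exy set21.
have /set2P vx : v \in [set x; y] by rewrite -Exy set22.
have /set2P xu : x \in [set u; v] by rewrite Exy set21.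
have /set2P yu : y \in [set u; v] by rewrite Exy set22.
by intuition congruence.
Qed.

Lemma card2_mem X u : #|X| = 2 -> u \in X -> exists2 v, u != v & X = [set u; v].
Proof.
move=> /eqP/cards2P[x [y [xy ->]]] /set2P[]->; first by exists y.
by exists x; rewrite 1?eq_sym // setUC.
Qed.

Lemma cardsD1_mem X x : x \in X -> #|X| = #|X :\ x|.+1.
Proof. by rewrite (cardsD1 x) => ->. Qed.

Lemma cardsD2 X x y : x \in X -> y \in X :\ x -> #|X| = #|X :\ x :\ y|.+2.
Proof. by move=> xX yX; rewrite (cardsD1_mem xX) (cardsD1_mem yX). Qed.

Lemma subD2set X x y : X :\ x :\ y \subset X.
Proof. exact: subset_trans (subD1set _ _) (subD1set _ _). Qed.

Lemma disjoint_neq A B x y : [disjoint A & B] -> x \in A -> y \in B -> x != y.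
Proof.
by move=> dAB xA yB; apply: contraTneq xA => ->; rewrite (disjointFl dAB).
Qed.

Lemma disjointD1 A B x : [disjoint A & B] -> [disjoint A :\ x & B].
Proof. exact/disjointWl/subD1set. Qed.

End FiniteSets.

(** * Walks *)

Section Walks.

Variable V : finType.
Implicit Types (G : rel V) (u v w x y : V) (s : seq V) (W : V * seq V).
Implicit Types (X : {set V}).

Definition is_walk G W := path G W.1 W.2.

Definition del_edge G u v : rel V :=
  fun x y => G x y && ([set x; y] != [set u; v]).

Lemma del_edge_sub G u v : subrel (del_edge G u v) G.
Proof. by move=> x y /andP[]. Qed.

Lemma sub_is_walk G G' W : subrel G G' -> is_walk G W -> is_walk G' W.
Proof. by move=> sGG'; apply: sub_path. Qed.

Lemma walk_edges_rcons x s y :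
  walk_edges (x, rcons s y) = rcons (walk_edges (x, s)) [set last x s; y].
Proof. by rewrite /walk_edges /=; elim: s x => //= z s IHs x; rewrite IHs. Qed.

Lemma walk_edges_adj G W X : is_walk G W -> X \in walk_edges W ->
  exists x y, G x y /\ X = [set x; y].
Proof.
case: W => x s; rewrite /is_walk /walk_edges /=.
elim: s x => //= y s IHs x /andP[Gxy Gs].
by rewrite inE => /orP[/eqP->|/IHs]; [exists x, y | apply].
Qed.

Lemma walk_extend G u w v W :
    symmetric G -> G u w -> is_walk G W -> walk_ends W = [set w; v] ->
  exists W', [/\ is_walk G W', walk_ends W' = [set u; v]
    & {subset walk_edges W' <= [set u; w] :: walk_edges W}].
Proof.
move=> symG Guw; case: W => x s; rewrite /is_walk /walk_ends /= => Gs.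
case/set2_inj=> -[xE lastE].
  by exists (u, x :: s); rewrite /= lastE xE Guw -xE Gs; split.
exists (x, rcons s u); rewrite /= rcons_path last_rcons lastE xE symG Guw.
split=> [||X]; rewrite -?xE ?Gs //; first exact: setUC.
by rewrite walk_edges_rcons mem_rcons lastE setUC.
Qed.

Lemma walk_shorten G W : is_walk G W ->
  exists W', [/\ is_walk G W', uniq (W'.1 :: W'.2), walk_ends W' = walk_ends W
    & {subset walk_edges W' <= walk_edges W}].
Proof.
case: W => x s; rewrite /is_walk /walk_ends /= => Gs.
pose H (L : seq {set V}) := [rel u v | G u v && ([set u; v] \in L)].
have Hs : path (H (walk_edges (x, s))) x s.
  suff sub L : {subset walk_edges (x, s) <= L} -> path (H L) x s.
    exact: sub.
  elim: s x Gs => //= y s IHs x /andP[Gxy Gs] sub.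
  rewrite Gxy sub ?mem_head //=.
  by apply: IHs => // X Xs; apply: sub; rewrite in_cons; apply/orP; right.
case/shortenP: Hs => s' Hs' uniq_s' _; exists (x, s'); split=> //.
  by apply: sub_path Hs' => u v /andP[].
by move=> X /(walk_edges_adj (W := (x, s')) Hs')[u [v [/andP[_ uvs] ->]]].
Qed.

End Walks.

(** * Demands and routings *)

Section Demands.

Variables V E : finType.
Implicit Types (f : E -> {set V}) (d e : E) (u v w : V).
Implicit Types (F : {set E}) (R S X : {set V}).

(* The demand e joins the two elements of f e; once it has been met, f e is   *)
(* empty.                                                                     *)
Definition demands f := [set e | f e != set0].
Definition demands_at f v := [set e | v \in f e].
Definition touching f S := [set e | ~~ [disjoint f e & S]].
Definition load f := #|demands f|.
Definition deg f v := #|demands_at f v|.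
Definition demands_in S f :=
  forall e, f e != set0 -> #|f e| = 2 /\ f e \subset S.

Lemma mem_nonempty f e v : v \in f e -> f e != set0.
Proof. by move=> ve; apply/set0Pn; exists v. Qed.

Lemma deg_gt0P f v : reflect (exists e, v \in f e) (0 < deg f v).
Proof.
rewrite card_gt0; apply: (iffP (set0Pn _)) => -[e].
  by rewrite inE; exists e.
by exists e; rewrite inE.
Qed.

Lemma demands_in_pair S f e u : demands_in S f -> u \in f e ->
  exists v, [/\ u != v, f e = [set u; v], u \in S & v \in S].
Proof.
move=> fS ue; have [card_fe /subsetP sub] := fS e (mem_nonempty ue).
have [v uv fe] := card2_mem card_fe ue; exists v.
by split=> //; apply: sub; rewrite // fe set22.
Qed.

Lemma demands_in_sub S R f : S \subset R -> demands_in S f -> demands_in R f.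
Proof. by move=> sSR fS e /fS[-> sub]; split=> //; apply: subset_trans sSR. Qed.

Lemma demands_in_subset S f e : demands_in S f -> f e \subset S.
Proof.
by move=> fS; have [->|/fS[]//] := eqVneq (f e) set0; apply: sub0set.
Qed.

Lemma demands_in_card S f e : demands_in S f -> #|f e| <= 2.
Proof.
by move=> fS; have [->|/fS[->]//] := eqVneq (f e) set0; rewrite cards0.
Qed.

Lemma demands_in_deg0 S f v : demands_in S f -> v \notin S -> deg f v = 0.
Proof.
move=> fS vS; apply/eqP; rewrite -leqn0 leqNgt.
apply: contra vS => /deg_gt0P[e].
exact: subsetP (demands_in_subset e fS) v.
Qed.

Lemma common_demand f u v : load f < deg f u + deg f v ->
  exists2 e, u \in f e & v \in f e.
Proof.
move=> loadf; have /card_gt0P[e] : 0 < #|demands_at f u :&: demands_at f v|.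
  have : #|demands_at f u :|: demands_at f v| <= load f.
    apply/subset_leq_card/subsetP => e; rewrite !inE.
    by case/orP; apply: mem_nonempty.
  have := cardsUI (demands_at f u) (demands_at f v).
  by move: loadf; rewrite /deg; nat_lia.
by rewrite !inE => /andP[]; exists e.
Qed.

Lemma touching_demands f S : touching f S \subset demands f.
Proof.
apply/subsetP => e; rewrite !inE; apply: contraNneq => ->.
by rewrite -setI_eq0 set0I.
Qed.

Lemma deg_touching S f v : v \in S -> deg f v <= #|touching f S|.
Proof.
move=> vS; apply/subset_leq_card/subsetP => e; rewrite !inE => ve.
by apply/pred0Pn; exists v; rewrite /= ve.
Qed.

Lemma deg_add_touching S f v : (forall e, v \in f e -> [disjoint f e & S]) ->
  deg f v + #|touching f S| <= load f.
Proof.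
move=> disS; rewrite -cardsUI.
have -> : demands_at f v :&: touching f S = set0.
  by apply/setP => e; rewrite !inE; case: (boolP (v \in f e)) => // /disS->.
rewrite cards0 addn0; apply: subset_leq_card.
rewrite subUset touching_demands andbT.
by apply/subsetP => e; rewrite !inE; apply: mem_nonempty.
Qed.

Lemma sum_deg S f : \sum_(v in S) deg f v = \sum_e #|S :&: f e|.
Proof.
under eq_bigr => v _ do rewrite /deg -sum1_card big_mkcond /=.
rewrite exchange_big /=; apply: eq_bigr => e _.
rewrite -sum1_card [RHS]big_mkcond [LHS]big_mkcond /=.
by apply: eq_bigr => v _; rewrite !inE; case: (v \in S); case: (v \in f e).
Qed.

Lemma sum_deg_touching c S f : (forall e, #|S :&: f e| <= c) ->
  \sum_(v in S) deg f v <= c * #|touching f S|.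
Proof.
move=> Sc; rewrite sum_deg -sum1_card big_distrr /= [leqRHS]big_mkcond /=.
apply: leq_sum => e _; rewrite inE muln1; case: ifP => //= /negbFE.
by rewrite disjoint_sym -setI_eq0 => /eqP->; rewrite cards0.
Qed.

Lemma demands_in_cardI R S f e : demands_in R f -> #|S :&: f e| <= 2.
Proof.
move=> fR; apply: leq_trans (demands_in_card e fR).
exact/subset_leq_card/subsetIr.
Qed.

Definition matching f F :=
  {in F &, forall d e, d != e -> [disjoint f d & f e]} /\ F \subset demands f.

Lemma matching1 f e : e \in demands f -> matching f [set e].
Proof.
move=> fe; split; last by rewrite sub1set.
by move=> d d' /set1P-> /set1P->; rewrite eqxx.
Qed.

Definition assign f e X : E -> {set V} := fun d => if d == e then X else f d.

(* A demand one end of which is moved to its other end is met.                *)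
Definition move_end u w X := if w \in X then X :\ u :\ w else w |: X :\ u.

Definition reroute f e u w := assign f e (move_end u w (f e)).

Definition meet F f : E -> {set V} := fun e => if e \in F then set0 else f e.

Lemma assign_eq f e X : assign f e X e = X.
Proof. by rewrite /assign eqxx. Qed.

Lemma assign_neq f e d X : d != e -> assign f e X d = f d.
Proof. by rewrite /assign => /negbTE->. Qed.

Lemma reroute_neq f e d u w : d != e -> reroute f e u w d = f d.
Proof. exact: assign_neq. Qed.

Lemma move_end_pair u v w : u != v -> u != w ->
  move_end u w [set u; v] = if w == v then set0 else [set w; v].
Proof.
move=> uv uw; rewrite /move_end !inE [w == u]eq_sym (negbTE uw) /=.
have uvD : [set u; v] :\ u = [set v] by rewrite setU1K // inE.
by case: eqVneq => [->|_]; rewrite uvD // setDv.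
Qed.

Lemma move_end_card2 u w X :
  #|X| = 2 -> u \in X -> u != w -> w \in X -> move_end u w X = set0.
Proof.
move=> card_X uX uw wX; have [v uv XE] := card2_mem card_X uX.
move: wX; rewrite XE move_end_pair // !inE [w == u]eq_sym (negbTE uw) /=.
by move=> /eqP->; rewrite eqxx.
Qed.

Lemma move_end_trans u v w X : v \notin X -> v != w -> u != w ->
  move_end v w (move_end u v X) = move_end u w X.
Proof.
move=> vX vw uw.
rewrite /move_end (negbTE vX) !inE [w == v]eq_sym (negbTE vw) /=.
by rewrite [w == u]eq_sym (negbTE uw) setU1K // !inE (negbTE vX) andbF.
Qed.

Lemma deg_assign f e X v :
  deg (assign f e X) v + (v \in f e) = deg f v + (v \in X).
Proof.
rewrite /deg (cardsD1 e) [in RHS](cardsD1 e) !inE assign_eq.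
have -> : demands_at (assign f e X) v :\ e = demands_at f v :\ e.
  by apply/setP => d; rewrite !inE /assign; case: eqP.
by lia.
Qed.

Lemma load_assign f e X :
  load (assign f e X) + (f e != set0) = load f + (X != set0).
Proof.
rewrite /load (cardsD1 e) [in RHS](cardsD1 e) !inE assign_eq.
have -> : demands (assign f e X) :\ e = demands f :\ e.
  by apply/setP => d; rewrite !inE /assign; case: eqP.
by lia.
Qed.

Lemma deg_reroute_neq f e u w v :
  v != u -> v != w -> deg (reroute f e u w) v = deg f v.
Proof.
move=> vu vw; have := deg_assign f e (move_end u w (f e)) v.
rewrite -/(reroute f e u w) /move_end.
by case: ifP => _; rewrite !inE ?vu ?vw ?(negbTE vw) /=; nat_lia.
Qed.

Lemma deg_reroute_src f e u w : u \in f e -> u != w ->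
  (deg (reroute f e u w) u).+1 = deg f u.
Proof.
move=> ue uw; have := deg_assign f e (move_end u w (f e)) u.
rewrite -/(reroute f e u w) /move_end ue.
by case: ifP => _; rewrite !inE eqxx (negbTE uw) /=; nat_lia.
Qed.

Lemma deg_reroute_dst f e u w :
  deg (reroute f e u w) w + (w \in f e) = deg f w + (w \notin f e).
Proof. by rewrite deg_assign /move_end; case: ifP => _; rewrite !inE eqxx. Qed.

Lemma load_reroute S f e u w : demands_in S f -> u \in f e -> u != w ->
  load (reroute f e u w) + (w \in f e) = load f.
Proof.
move=> fS ue uw; have := load_assign f e (move_end u w (f e)).
have ne := mem_nonempty ue; rewrite -/(reroute f e u w) ne.
have [we|we] := boolP (w \in f e).
  by rewrite (move_end_card2 (fS e ne).1) // eqxx; nat_lia.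
rewrite /move_end (negbTE we); have -> : w |: f e :\ u != set0.
  by apply/set0Pn; exists w; apply: setU11.
by nat_lia.
Qed.

Lemma demands_in_reroute S f e u w :
    demands_in S f -> u \in f e -> u != w -> w \in S ->
  demands_in S (reroute f e u w).
Proof.
move=> fS ue uw wS d; rewrite /reroute /assign.
case: (d =P e) => [_|_]; last exact: fS.
have [v [uv -> _ vS]] := demands_in_pair fS ue; rewrite move_end_pair //.
case: (eqVneq w v) => [_|wv _]; first by rewrite eqxx.
by rewrite cards2 wv subUset !sub1set wS.
Qed.

Lemma demands_in_meet S F f : demands_in S f -> demands_in S (meet F f).
Proof.
by move=> fS e; rewrite /meet; case: ifP => _; [rewrite eqxx | exact: fS].
Qed.

Lemma deg_meet F f v : deg (meet F f) v + #|F :&: demands_at f v| = deg f v.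
Proof.
rewrite /deg -(cardsID F (demands_at f v)) setIC addnC; congr (_ + _).
by apply: eq_card => e; rewrite !inE /meet; case: (e \in F); rewrite ?inE.
Qed.

Lemma load_meet F f : load (meet F f) + #|F :&: demands f| = load f.
Proof.
rewrite /load -(cardsID F (demands f)) setIC addnC; congr (_ + _).
by apply: eq_card => e; rewrite !inE /meet; case: (e \in F); rewrite ?eqxx.
Qed.

End Demands.

Section Routing.

Variables V E : finType.
Implicit Types (G : rel V) (f : E -> {set V}) (d e : E) (u w : V).
Implicit Types (P : E -> V * seq V) (W : V * seq V) (X : {set V}).

Definition routes G f P : Prop :=
  (forall e, f e != set0 -> is_walk G (P e) /\ walk_ends (P e) = f e) /\
  (forall d e, f d != set0 -> f e != set0 -> d != e ->
     [disjoint walk_edges (P d) & walk_edges (P e)]).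

Definition routable G f : Prop := exists P, routes G f P.

Lemma sub_routable G G' f : subrel G G' -> routable G f -> routable G' f.
Proof.
move=> sGG' [P [walkP disP]]; exists P; split=> // e /walkP[GP ->].
by split; first exact: sub_is_walk GP.
Qed.

Lemma eq_routable G f f' : f =1 f' -> routable G f -> routable G f'.
Proof.
move=> ff' [P [walkP disP]]; exists P.
by split=> [e|d e]; rewrite -!ff'; [exact: walkP | exact: disP].
Qed.

Lemma routes_assign G G' f e X P W :
    subrel G' G -> routes G' (assign f e X) P ->
    is_walk G W -> walk_ends W = f e ->
    (forall d, d != e -> f d != set0 ->
       [disjoint walk_edges W & walk_edges (P d)]) ->
  routes G f (fun d => if d == e then W else P d).
Proof.
move=> sG'G [walkP disP] GW endsW disW; split=> [d fd|c d fc fd].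
  case: (eqVneq d e) => [->|de]; first by split.
  have := walkP d; rewrite assign_neq // => /(_ fd)[GP endsP].
  by split; first exact: sub_is_walk GP.
case: (eqVneq c e) => [->|ce]; case: (eqVneq d e) => [_|de] //.
- by move=> _; apply: disW.
- by move=> _; rewrite disjoint_sym; apply: disW.
- by have := disP c d; rewrite !assign_neq //; apply.
Qed.

Lemma routable_reroute G f e u w :
    symmetric G -> G u w -> #|f e| = 2 -> u \in f e -> u != w ->
  routable (del_edge G u w) (reroute f e u w) -> routable G f.
Proof.
move=> symG Guw card_fe ue uw [P routesP]; have [walkP disP] := routesP.
have [v uv fe] := card2_mem card_fe ue.
pose W := if w == v then (w, [::]) else P e.
have [GW endsW disW] : [/\ is_walk (del_edge G u w) W,
    walk_ends W = [set w; v]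
    & forall d, d != e -> f d != set0 ->
        [disjoint walk_edges W & walk_edges (P d)]].
  have moved : reroute f e u w e = if w == v then set0 else [set w; v].
    by rewrite /reroute assign_eq fe move_end_pair.
  rewrite /W; case: (eqVneq w v) moved => [->|wv] moved.
    by split=> // d _ _; apply/pred0P.
  have unmet : reroute f e u w e != set0.
    by rewrite moved; apply/set0Pn; exists w; apply: set21.
  have [GP endsP] := walkP e unmet.
  split=> // [|d de fd]; first by rewrite endsP.
  by apply: disP => //; rewrite ?reroute_neq // eq_sym.
have {}GW := sub_is_walk (@del_edge_sub _ G u w) GW.
have [W' [GW' endsW' subW']] := walk_extend symG Guw GW endsW.
exists (fun d => if d == e then W' else P d).
apply: (routes_assign (@del_edge_sub _ G u w) routesP GW').
  by rewrite endsW'.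
move=> d de fd; apply/pred0P => X /=; apply/negP => /andP[/subW' XW' Xd].
move: XW'; rewrite inE => /orP[/eqP XE|XW]; last first.
  by have /pred0P/(_ X) := disW d de fd; rewrite /= XW Xd.
have := walkP d; rewrite reroute_neq // => /(_ fd)[GP _].
by have [x [y [/andP[_ /eqP xy] /esym]]] := walk_edges_adj GP Xd; rewrite XE.
Qed.

Lemma routable_load1 G f e W :
    load f <= 1 -> is_walk G W -> walk_ends W = f e -> f e != set0 ->
  routable G f.
Proof.
move=> load_le1 GW endsW fe; have only d : f d != set0 -> d = e.
  by move=> fd; apply: (card_le1_eqP load_le1); rewrite inE.
exists (fun=> W); split=> [d /only->|d d' /only-> /only->]; first by split.
by rewrite eqxx.
Qed.

End Routing.

Lemma realizable_of_routable (V : finType) (G : sgraph V) (D : multigraph V) :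
  routable G (@ends _ D) -> realizable G D.
Proof.
case=> P [walkP disP].
have ends0 (e : edge D) : ends e != set0 by rewrite -card_gt0 edge_ends.
pose shortcut e W := [/\ is_path G W, walk_ends W = ends e
  & {subset walk_edges W <= walk_edges (P e)}].
have [Q QP] : exists Q, forall e, shortcut e (Q e).
  apply: (@fin_all_exists _ _ shortcut) => e.
  have [GP endsP] := walkP e (ends0 e).
  have [W [GW uniqW endsW subW]] := walk_shorten GP.
  by exists W; split; rewrite ?endsW // /is_path uniqW andbT.
exists Q; split=> [e|d e de]; first by have [] := QP e.
have [[_ _ subQd] [_ _ subQe]] := (QP d, QP e).
apply/pred0P => X /=; apply/negP => /andP[/subQd Xd /subQe Xe].
by have /pred0P/(_ X) := disP d e (ends0 d) (ends0 e) de; rewrite /= Xd Xe.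
Qed.

(** * Complete bipartite graphs *)

Section Bipartite.

Variables V E : finType.
Implicit Types (f : E -> {set V}) (e : E) (a b x y : V) (A B : {set V}).

Definition bip A B : rel V :=
  fun x y => (x \in A) && (y \in B) || (x \in B) && (y \in A).

Definition fits A B f :=
  [/\ demands_in (A :|: B) f, {in A, forall x, deg f x <= #|B|}
    & {in B, forall y, deg f y <= #|A|}].

Definition pairable A B := forall f,
  fits A B f -> load f + 3 <= #|A| + #|B| -> routable (bip A B) f.

Definition separated A B f := forall e, (f e \subset A) || (f e \subset B).

Lemma bipC A B : bip A B =2 bip B A.
Proof. by move=> x y; rewrite /bip orbC. Qed.

Lemma bip_sym A B : symmetric (bip A B).
Proof. by move=> x y; rewrite /bip orbC andbC [X in _ || X]andbC. Qed.

Lemma routable_bipC A B f : routable (bip A B) f -> routable (bip B A) f.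
Proof. by apply: sub_routable => x y; rewrite bipC. Qed.

Lemma fitsC A B f : fits A B f -> fits B A f.
Proof. by case=> fAB dA dB; split=> //; rewrite setUC. Qed.

Lemma pairableC A B : pairable A B -> pairable B A.
Proof.
move=> pAB f /fitsC fitsf loadf.
by apply/routable_bipC/pAB; rewrite // [#|A| + _]addnC.
Qed.

Lemma separatedC A B f : separated A B f -> separated B A f.
Proof. by move=> sep e; rewrite orbC. Qed.

Lemma separatedVdirect A B f : demands_in (A :|: B) f ->
  separated A B f \/ exists e a b, [/\ a \in A, b \in B, a \in f e & b \in f e].
Proof.
move=> fAB.
have [/forallP|] := boolP [forall e, (f e \subset A) || (f e \subset B)].
  by left.
rewrite negb_forall => /existsP[e]; rewrite negb_or.
case/andP=> /subsetPn[b be bA] /subsetPn[a ae aB]; right.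
have inAB x : x \in f e -> x \in A :|: B := subsetP (demands_in_subset e fAB) x.
exists e, a, b; split=> //.
  by have := inAB a ae; rewrite inE (negbTE aB) orbF.
by have := inAB b be; rewrite inE (negbTE bA).
Qed.

Lemma routable_load_le1 A B f a b : a \in A -> b \in B ->
  demands_in (A :|: B) f -> load f <= 1 -> routable (bip A B) f.
Proof.
move=> aA bB fAB load_le1; have [none|/set0Pn[e]] := eqVneq (demands f) set0.
  have met e : f e = set0.
    by apply/eqP; apply: contraFT (in_set0 e); rewrite -none inE.
  by exists (fun=> (a, [::])); split=> [e|e d]; rewrite met eqxx.
rewrite inE => fe; have [u ue] := set0Pn _ fe.
have [v [uv feE uAB vAB]] := demands_in_pair fAB ue.
suff [W [GW endsW]] : exists W, is_walk (bip A B) W /\ walk_ends W = [set u; v].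
  by apply: (routable_load1 load_le1 GW _ fe); rewrite feE.
case/setUP: uAB => [uA|uB]; case/setUP: vAB => [vA|vB].
- by exists (u, [:: b; v]); rewrite /is_walk /= /bip uA vA bB orbT.
- by exists (u, [:: v]); rewrite /is_walk /= /bip uA vB.
- by exists (u, [:: v]); rewrite /is_walk /= /bip uB vA orbT.
- by exists (u, [:: a; v]); rewrite /is_walk /= /bip uB vB aA orbT.
Qed.

End Bipartite.

(** * Using up the star of a vertex *)

Section Hub.

Variables (V E : finType) (A B : {set V}) (a : V).
Hypotheses (aA : a \notin A) (aB : a \notin B) (dAB : [disjoint A & B]).
Implicit Types (f : E -> {set V}) (d e : E) (b v x y z : V).
Implicit Types (F : {set E}) (R S : {set V}).

(* R is the set of the vertices of B whose edge to a is still unused.         *)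
Definition hub R : rel V := fun x y => bip A B x y || bip [set a] R x y.

Lemma hub_sym R : symmetric (hub R).
Proof. by move=> x y; rewrite /hub !(bip_sym _ _ x y). Qed.

Lemma sub_hub R R' : R \subset R' -> subrel (hub R) (hub R').
Proof.
move=> /subsetP sR x y; rewrite /hub /bip.
by case/or3P => [->//|/andP[-> /sR->]|/andP[/sR-> ->]]; rewrite ?orbT.
Qed.

Lemma bip_sub_hub R : subrel (bip A B) (hub R).
Proof. by move=> x y; rewrite /hub => ->. Qed.

Lemma hub_bip : hub B =2 bip (a |: A) B.
Proof.
move=> x y; rewrite /hub /bip !inE.
by case: (x \in A); case: (x \in B); case: (y \in A); case: (y \in B);
  rewrite ?orbT ?andbF ?andbT ?orbF.
Qed.

Lemma hub_neq b : b \in B -> a != b.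
Proof. by move=> bB; apply: contraNneq aB => ->. Qed.

Lemma hub_edge R b : b \in R -> hub R a b.
Proof. by move=> bR; rewrite /hub /bip !inE eqxx bR orbT. Qed.

Lemma hub_del_edge R b : a != b -> subrel (hub (R :\ b)) (del_edge (hub R) a b).
Proof.
move=> ab x y hxy; rewrite /del_edge (sub_hub _ hxy) ?subD1set //=.
apply/negP => /eqP/set2_inj[] [xE yE]; move: hxy; rewrite xE yE /hub /bip !inE;
  by rewrite (negbTE aA) (negbTE aB) !eqxx [b == a]eq_sym (negbTE ab) /= ?andbF.
Qed.

Lemma hub_send S R f e b : demands_in S f -> a \in f e -> b \in R -> a != b ->
  routable (hub (R :\ b)) (reroute f e a b) -> routable (hub R) f.
Proof.
move=> fS ae bR ab; have [card_fe _] := fS e (mem_nonempty ae) => sent.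
apply: (routable_reroute (hub_sym R) (hub_edge bR) card_fe ae ab).
by apply: sub_routable sent; apply: hub_del_edge.
Qed.

Lemma hub_lift S R f e y z :
    demands_in S f -> R \subset B -> y \in R -> z \in R :\ y ->
    y \in f e -> a \notin f e ->
  routable (hub (R :\ y :\ z)) (reroute f e y z) -> routable (hub R) f.
Proof.
move=> fS sRB yR zRy ye ae lifted; have [card_fe _] := fS e (mem_nonempty ye).
have [zy zR] := setD1P zRy; have yz : y != z by rewrite eq_sym.
have [ay az] := (hub_neq (subsetP sRB y yR), hub_neq (subsetP sRB z zR)).
have ya : y != a by rewrite eq_sym.
have aR : hub R y a by rewrite hub_sym hub_edge.
apply: (routable_reroute (hub_sym R) aR card_fe ye ya).
have sub : subrel (hub (R :\ y)) (del_edge (hub R) y a).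
  by move=> u v /(hub_del_edge ay); rewrite /del_edge [[set y; a]]setUC.
apply: (sub_routable sub).
have aS : demands_in (a |: S) f by apply: demands_in_sub fS; apply: subsetUr.
have aS' := demands_in_reroute aS ye ya (setU11 _ _).
apply: (hub_send (e := e) (b := z) aS') => //.
  by rewrite /reroute assign_eq /move_end (negbTE ae) setU11.
apply: eq_routable lifted => d.
have [->|de] := eqVneq d e; last by rewrite !reroute_neq.
by rewrite /reroute !assign_eq move_end_trans.
Qed.

Lemma hub_meet S R f e y z :
    demands_in S f -> R \subset B -> y \in R -> z \in R :\ y ->
    f e = [set y; z] ->
  routable (hub (R :\ y :\ z)) (meet [set e] f) -> routable (hub R) f.
Proof.
move=> fS sRB yR zRy fe served; have [zy zR] := setD1P zRy.
have [ay az] := (hub_neq (subsetP sRB y yR), hub_neq (subsetP sRB z zR)).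
have yz : y != z by rewrite eq_sym.
apply: (hub_lift (e := e) fS sRB yR zRy).
- by rewrite fe set21.
- by rewrite fe !inE negb_or ay.
apply: eq_routable served => d; rewrite /meet inE /reroute /assign.
by case: (d =P e) => // _; rewrite fe move_end_pair // eqxx.
Qed.

Lemma hub_matching S R f F : demands_in S f -> R \subset B -> matching f F ->
    {in F, forall e, f e \subset R} ->
  routable (bip A B) (meet F f) -> routable (hub R) f.
Proof.
have [n] := ubnP #|F|.
elim: n R f F => // n IHn R f F cardF fS sRB [disF subF] FR met.
have [noF|/set0Pn[e eF]] := eqVneq F set0.
  apply: (sub_routable (@bip_sub_hub R)); apply: eq_routable met => e.
  by rewrite /meet noF inE.
have /set0Pn[y ye] : f e != set0 by have := subsetP subF e eF; rewrite inE.
have [z [yz fe _ _]] := demands_in_pair fS ye.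
have ze : z \in f e by rewrite fe set22.
have yR := subsetP (FR e eF) y ye; have zR : z \in R :\ y.
  by rewrite in_setD1 eq_sym yz (subsetP (FR e eF)).
have metE d : d \in F :\ e -> meet [set e] f d = f d.
  by rewrite !inE /meet inE => /andP[/negbTE->].
have FD := subsetP (subD1set F e).
apply: (hub_meet fS sRB yR zR fe); apply: (IHn _ _ (F :\ e)).
- by rewrite (cardsD1_mem eF) in cardF.
- exact: demands_in_meet.
- exact: subset_trans (subD2set _ _ _) sRB.
- split=> [c d cF dF cd|]; first by rewrite !metE // disF // FD.
  apply/subsetP => d dF; rewrite inE metE //.
  by have := subsetP subF d (FD d dF); rewrite inE.
- move=> d dFe; rewrite metE //; have [de dF] := setD1P dFe.
  apply/subsetP => x xd; rewrite !in_setD1 (subsetP (FR d dF) x xd) andbT.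
  have dis := disF d e dF eF de.
  by apply/andP; split; apply: contraTneq xd => ->; rewrite (disjointFl dis).
apply: eq_routable met => d; rewrite /meet !inE.
by case: (eqVneq d e) => [->|]; rewrite ?eF.
Qed.

(* By the bound on the degrees, different demands at a are moved to different *)
(* vertices of R.                                                             *)
Definition scattered R f f' :=
  [/\ forall e, a \notin f e -> f' e = f e,
      forall e, a \in f e -> exists2 b, b \in R & f' e = move_end a b (f e),
      forall v, deg f' v <= deg f v + (v \in R)
    & load f' <= load f].

Lemma hub_send_all R f :
    R \subset B -> demands_in (a |: (A :|: B)) f -> deg f a <= #|R| ->
  exists f', [/\ scattered R f f', demands_in (A :|: B) f'
    & routable (bip A B) f' -> routable (hub R) f].
Proof.
have [n] := ubnP (deg f a); elim: n R f => // n IHn R f deg_lt sRB fS deg_aR.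
have [/deg_gt0P[e ae]|deg_a0] := boolP (0 < deg f a); last first.
  have nota e : a \notin f e.
    by apply: contra deg_a0 => ae; apply/deg_gt0P; exists e.
  exists f; split; last by apply: sub_routable; apply: bip_sub_hub.
    by split=> // [e|v]; [rewrite (negbTE (nota e)) | apply: leq_addr].
  move=> e /fS[-> sub]; split=> //; apply/subsetP => x xe.
  have := subsetP sub x xe; rewrite in_setU1 => /orP[/eqP xa|//].
  by have := nota e; rewrite -xa xe.
have /card_gt0P[b bR] : 0 < #|R|.
  by apply: leq_trans deg_aR; apply/deg_gt0P; exists e.
have bB := subsetP sRB b bR; have ab := hub_neq bB.
have deg_a := deg_reroute_src ae ab; have cardR := cardsD1_mem bR.
have fS' : demands_in (a |: (A :|: B)) (reroute f e a b).
  by apply: demands_in_reroute; rewrite // !inE bB !orbT.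
have [|||f' [[off_a at_a deg_le load_le] fAB back]] :=
  IHn (R :\ b) (reroute f e a b) _ _ fS' _.
- by nat_lia.
- by apply: subset_trans (subD1set _ _) sRB.
- by nat_lia.
exists f'; split=> //; last by move=> /back; apply: hub_send fS ae bR ab.
have ae' : a \notin reroute f e a b e.
  rewrite /reroute assign_eq /move_end.
  by case: ifP => _; rewrite !inE ?eqxx ?(negbTE ab) ?andbF.
split=> [d ad|d ad|v|].
- by rewrite off_a reroute_neq //; apply: contraNneq ad => ->.
- have [->|de] := eqVneq d e.
    by exists b; rewrite // off_a // /reroute assign_eq.
  have [|c] := at_a d; rewrite reroute_neq //.
  by case/setD1P=> _ cR; exists c.
- apply: leq_trans (deg_le v) _; rewrite in_setD1.
  have [->|va] := eqVneq v a; first by nat_lia.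
  have [->|vb] := eqVneq v b; last by rewrite deg_reroute_neq.
  by have := deg_reroute_dst f e a b; rewrite bR /=; nat_lia.
- by apply: leq_trans load_le _; have := load_reroute fS ae ab; nat_lia.
Qed.

Definition hub_fits R f :=
  [/\ R \subset B, demands_in (a |: (A :|: B)) f,
      {in A, forall x, deg f x <= #|B|}
    & {in B, forall y, deg f y <= #|A| + (y \in R)}].

Definition no_direct R f := forall e, a \in f e -> [disjoint f e & R].

Definition heavy k R f := [set y in R | k <= deg f y].

Local Notation saturated := (heavy #|A|).
Local Notation full := (heavy #|A|.+1).

(* A saturated vertex cannot take over a demand from a.  Full vertices have   *)
(* to be relieved: two of them by one common demand, the last one, if their   *)
(* number is odd, by passing a demand on to a vertex that is not saturated.   *)
Definition has_room R f := deg f a + #|saturated R f| + odd #|full R f| <= #|R|.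

Definition balanced R f := [/\ hub_fits R f, no_direct R f & has_room R f].

Lemma sub_heavy k R f : heavy k R f \subset R.
Proof. by apply/subsetP => y; rewrite inE => /andP[]. Qed.

Lemma sub_heavyS k R f : heavy k.+1 R f \subset heavy k R f.
Proof. by apply/subsetP => y; rewrite !inE => /andP[->] /ltnW. Qed.

Lemma heavyD1 k R f y : heavy k (R :\ y) f = heavy k R f :\ y.
Proof. by apply/setP => z; rewrite !inE andbA. Qed.

Lemma eq_heavy k R f f' : {in R, deg f =1 deg f'} -> heavy k R f = heavy k R f'.
Proof.
move=> eq_deg; apply/setP => y; rewrite !inE.
by case: (boolP (y \in R)) => // /eq_deg->.
Qed.

Lemma card_heavy_light k R f :
  #|heavy k R f| + #|[set y in R | deg f y < k]| = #|R|.
Proof.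
rewrite -(cardsID [set y | k <= deg f y] R).
by congr (_ + _); apply: eq_card => y; rewrite !inE // -ltnNge andbC.
Qed.

Lemma heavy_sum k R f : k * #|heavy k R f| + #|heavy k.+1 R f| <=
  \sum_(y in heavy k R f) deg f y.
Proof.
have -> : #|heavy k.+1 R f| = \sum_(y in heavy k R f) (y \in heavy k.+1 R f).
  rewrite -sum1_card [RHS]big_mkcond [LHS]big_mkcond; apply: eq_bigr => y _.
  by case: ifP => [/(subsetP (sub_heavyS _ _ _))->|_] //; case: ifP.
rewrite mulnC -sum_nat_const -big_split /=; apply: leq_sum => y.
by rewrite !inE => /andP[-> ky] /=; case: ltnP => /=; nat_lia.
Qed.

Lemma heavy_touching k c R f : (forall e, #|heavy k R f :&: f e| <= c) ->
  k * #|heavy k R f| + #|heavy k.+1 R f| <= c * #|touching f (heavy k R f)|.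
Proof. by move=> /sum_deg_touching; apply: leq_trans; apply: heavy_sum. Qed.

Lemma no_direct_heavy k R f : no_direct R f ->
  deg f a + #|touching f (heavy k R f)| <= load f.
Proof.
move=> nodir; apply: deg_add_touching => e /nodir.
by apply: disjointWr; apply: sub_heavy.
Qed.

Lemma hub_fits_reroute R R' f e u w :
    hub_fits R f -> R' \subset R -> u \in f e -> u != w -> w \in R ->
    deg (reroute f e u w) w <= #|A| + (w \in R') ->
    {in R :\: R', forall y, y = u \/ y = w} ->
  hub_fits R' (reroute f e u w).
Proof.
move=> [sRB fS fA fB] sR'R ue uw wR deg_w used.
have wB := subsetP sRB w wR; have deg_u := deg_reroute_src ue uw.
have deg_neq v : v != w -> deg (reroute f e u w) v + (v == u) = deg f v.
  move=> vw; have [->|vu] := eqVneq v u; first by rewrite addn1.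
  by rewrite deg_reroute_neq // addn0.
split.
- exact: subset_trans sRB.
- by apply: demands_in_reroute; rewrite // !inE wB !orbT.
- move=> x xA; have := deg_neq x (disjoint_neq dAB xA wB).
  by have := fA x xA; nat_lia.
- move=> y yB; have [->//|yw] := eqVneq y w.
  have := deg_neq y yw; have := fB y yB.
  have [yR'|yR'] := boolP (y \in R').
    by rewrite (subsetP sR'R y yR'); nat_lia.
  have [yR|_] := boolP (y \in R); last by nat_lia.
  have [|->|yw'] := used y; first by rewrite inE yR' yR.
    by rewrite eqxx; nat_lia.
  by rewrite yw' eqxx in yw.
Qed.

Lemma hub_send_direct R f e b :
    hub_fits R f -> b \in R -> a \in f e -> b \in f e ->
  [/\ hub_fits (R :\ b) (reroute f e a b),
      (deg (reroute f e a b) a).+1 = deg f a,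
      (load (reroute f e a b)).+1 = load f
    & routable (hub (R :\ b)) (reroute f e a b) -> routable (hub R) f].
Proof.
move=> hubf bR ae be; have [sRB fS _ fB] := hubf; have bB := subsetP sRB b bR.
have ab := hub_neq bB; split.
- apply: (hub_fits_reroute hubf) => //; first exact: subD1set.
    have := deg_reroute_dst f e a b; have := fB b bB.
    by rewrite bR be /=; nat_lia.
  by move=> x /setDP[xR]; rewrite in_setD1 xR andbT negbK => /eqP; right.
- exact: deg_reroute_src.
- by have := load_reroute fS ae ab; rewrite be addn1.
- exact: hub_send fS ae bR ab.
Qed.

Lemma hub_fits_lift R f e y z :
    hub_fits R f -> y \in R -> z \in R :\ y -> y \in f e ->
    z \in f e \/ deg f z < #|A| ->
  hub_fits (R :\ y :\ z) (reroute f e y z).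
Proof.
move=> hubf yR /setD1P[zy zR] ye relief; have [sRB _ _ fB] := hubf.
apply: (hub_fits_reroute hubf) => //; rewrite 1?eq_sym ?subD2set //.
  have := deg_reroute_dst f e y z; have := fB z (subsetP sRB z zR); rewrite zR.
  by case: relief => [->|]; [|case: (z \in f e)] => /=; nat_lia.
move=> x /setDP[xR]; rewrite !in_setD1 xR andbT negb_and !negbK.
by case/orP=> /eqP; [right | left].
Qed.

Lemma no_direct_notin R f e y :
  no_direct R f -> y \in R -> y \in f e -> a \notin f e.
Proof.
by move=> nodir yR ye; apply/negP => /nodir/pred0P/(_ y) /=; rewrite ye yR.
Qed.

Lemma no_direct_reroute R f e y z : no_direct R f -> a \notin f e -> a != z ->
  no_direct (R :\ y :\ z) (reroute f e y z).
Proof.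
move=> nodir ae az d; have [->|de] := eqVneq d e.
  rewrite /reroute assign_eq /move_end.
  by case: ifP => _; rewrite !inE (negbTE ae) ?andbF // (negbTE az).
by rewrite reroute_neq // => /nodir; apply: disjointWr; apply: subD2set.
Qed.

Lemma has_room_reroute R f e y z : R \subset B -> y \in R -> z \in R ->
  has_room (R :\ y :\ z) (reroute f e y z) = has_room (R :\ y :\ z) f.
Proof.
move=> /subsetP sRB yR zR.
have [ay az] := (hub_neq (sRB y yR), hub_neq (sRB z zR)).
have eq_deg : {in R :\ y :\ z, deg (reroute f e y z) =1 deg f}.
  by move=> x; rewrite !in_setD1 => /and3P[xz xy _]; rewrite deg_reroute_neq.
by rewrite /has_room deg_reroute_neq // !(eq_heavy _ eq_deg).
Qed.

Lemma balanced_lift R f e y z :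
    hub_fits R f -> no_direct R f -> has_room (R :\ y :\ z) f ->
    y \in R -> z \in R :\ y -> y \in f e -> z \in f e \/ deg f z < #|A| ->
  [/\ balanced (R :\ y :\ z) (reroute f e y z),
      load (reroute f e y z) + (z \in f e) = load f
    & routable (hub (R :\ y :\ z)) (reroute f e y z) -> routable (hub R) f].
Proof.
move=> hubf nodir room yR zRy ye relief; have [sRB fS _ _] := hubf.
have [zy zR] := setD1P zRy; have yz : y != z by rewrite eq_sym.
have ae := no_direct_notin nodir yR ye; split.
- split; first exact: hub_fits_lift.
    exact: no_direct_reroute nodir ae (hub_neq (subsetP sRB z zR)).
  by rewrite has_room_reroute.
- exact: load_reroute fS ye yz.
- exact: hub_lift fS sRB yR zRy ye ae.
Qed.

Lemma has_room_full2 R f y z : has_room R f ->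
    y \in full R f -> z \in full R f :\ y ->
  has_room (R :\ y :\ z) f.
Proof.
rewrite /has_room !heavyD1 => room yF zF.
have sFS := sub_heavyS #|A| R f; have sSR := sub_heavy #|A| R f.
have yS := subsetP sFS y yF; have zS := subsetP (setSD [set y] sFS) z zF.
have yR := subsetP sSR y yS; have zR := subsetP (setSD [set y] sSR) z zS.
move: room; rewrite (cardsD2 yF zF) (cardsD2 yS zS) (cardsD2 yR zR) /= negbK.
by nat_lia.
Qed.

Lemma has_room_full1 R f y z : has_room R f -> full R f = [set y] ->
  z \in R :\ y -> has_room (R :\ y :\ z) f.
Proof.
rewrite /has_room !heavyD1 => room fullE zR.
have yS : y \in saturated R f.
  by apply: (subsetP (sub_heavyS _ _ _)); rewrite fullE set11.
have := cardsD2 (subsetP (sub_heavy _ _ _) y yS) zR; have := cardsD1_mem yS.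
have := subset_leq_card (subD1set (saturated R f :\ y) z).
by move: room; rewrite fullE cards1 setDv set0D cards0 /=; nat_lia.
Qed.

(* The degrees of two full vertices add up to more than the load.             *)
Lemma full_cases R f : load f < #|A|.+1.*2 -> full R f != set0 ->
  (exists e y, y \in f e /\ full R f = [set y]) \/
  (exists e y z,
     [/\ y \in full R f, z \in full R f :\ y, y \in f e & z \in f e]).
Proof.
move=> loadf /set0Pn[y yF]; have := yF; rewrite inE => /andP[_ deg_y].
have [alone|/set0Pn[z zF]] := eqVneq (full R f :\ y) set0; [left | right].
  have [e ye] : exists e, y \in f e by apply/deg_gt0P; nat_lia.
  by exists e, y; rewrite -(setD1K yF) alone setU0.
have := zF; rewrite in_setD1 inE => /and3P[_ _ deg_z].
have [e ye ze] : exists2 e, y \in f e & z \in f e.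
  by apply: common_demand; nat_lia.
by exists e, y, z.
Qed.

Lemma full_relief R f :
    has_room R f -> load f < #|A|.+1.*2 -> full R f != set0 ->
  exists e y z, [/\ y \in R, z \in R :\ y, y \in f e,
    z \in f e \/ deg f z < #|A| & has_room (R :\ y :\ z) f].
Proof.
move=> room loadf /(full_cases loadf).
case=> [[e [y [ye fullE]]]|[e [y [z [yF zF ye ze]]]]].
  have : y \in full R f by rewrite fullE set11.
  rewrite inE => /andP[yR deg_y].
  have /card_gt0P[z] : 0 < #|[set z in R | deg f z < #|A|]|.
    have := card_heavy_light #|A| R f.
    by move: room; rewrite /has_room fullE cards1; nat_lia.
  rewrite inE => /andP[zR deg_z]; have zRy : z \in R :\ y.
    by rewrite in_setD1 zR andbT; apply: contraTneq deg_z => ->; nat_lia.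
  by exists e, y, z; split=> //; [right | apply: has_room_full1].
have sFR := sub_heavy #|A|.+1 R f; exists e, y, z; split=> //.
- exact: subsetP sFR y yF.
- exact: subsetP (setSD _ sFR) z zF.
- by left.
- exact: has_room_full2.
Qed.

Lemma no_direct_has_room R f :
    hub_fits R f -> no_direct R f -> 1 < #|A| -> deg f a <= #|R| ->
    load f + 2 <= #|A| + #|R| ->
  has_room R f.
Proof.
move=> [_ fS _ _] nodir A_gt1 deg_a loadf; rewrite /has_room.
have saturated_le :=
  heavy_touching (fun e => demands_in_cardI (saturated R f) e fS).
have touch_le := no_direct_heavy #|A| nodir.
have deg_le y : y \in saturated R f -> deg f y <= #|touching f (saturated R f)|.
  exact: deg_touching.
have sFS := sub_heavyS #|A| R f; have full_le := subset_leq_card sFS.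
have [saturated0|/card_gt0P[y yS]] := posnP #|saturated R f|.
  by move: full_le; rewrite saturated0 leqn0 => /eqP->; rewrite !addn0.
have [saturated_le1|saturated_gt1] := leqP #|saturated R f| 1; last first.
  have : 2 * #|saturated R f| + 2 * #|A| <= #|A| * #|saturated R f| + 4.
    by move: A_gt1 saturated_gt1; clear; nia.
  by have := odd_double_half #|full R f|; nat_lia.
have : #|A| + #|full R f| <= #|touching f (saturated R f)|.
  have [->|/card_gt0P[z zF]] := posnP #|full R f|.
    by apply: leq_trans (deg_le y yS); move: yS; rewrite inE addn0 => /andP[].
  have := deg_le z (subsetP sFS z zF); move: zF; rewrite inE => /andP[_].
  by nat_lia.
by case: (odd _) (erefl (odd #|full R f|)) => /=; nat_lia.
Qed.

(** * Demands between the neighbours of the removed vertex *)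

Definition servable f := exists e y z,
  [/\ y \in B, z \in B :\ y, y \in f e, z \in f e & has_room (B :\ y :\ z) f].

Lemma hub_disjoint : [disjoint a |: A & B].
Proof.
by rewrite disjoints_subset subUset sub1set inE aB -disjoints_subset.
Qed.

Lemma separated_no_direct f : separated (a |: A) B f -> no_direct B f.
Proof.
move=> sep e ae; case/orP: (sep e) => [sub|/subsetP/(_ a ae)].
  exact: disjointWl sub hub_disjoint.
by rewrite (negbTE aB).
Qed.

Section Servable.

Variable f : E -> {set V}.
Hypotheses (fS : demands_in (a |: (A :|: B)) f) (sep : separated (a |: A) B f).
Hypotheses (A_gt1 : 1 < #|A|) (leAB : #|A| <= #|B|) (leBA : #|B| <= #|A|.+1).
Hypotheses (loadf : load f + 2 <= #|A| + #|B|) (room : has_room B f).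

Lemma separated_partner e y : y \in B -> y \in f e ->
  exists2 z, z \in B :\ y & z \in f e.
Proof.
move=> yB ye; have [z [yz fe _ _]] := demands_in_pair fS ye.
have ze : z \in f e by rewrite fe set22.
exists z => //; rewrite in_setD1 eq_sym yz.
case/orP: (sep e) => /subsetP sub; last exact: sub.
by have := sub y ye; rewrite (disjointFl hub_disjoint).
Qed.

Lemma servable_full : full B f != set0 -> servable f.
Proof.
have load_lt : load f < #|A|.+1.*2 by nat_lia.
case/(full_cases load_lt)=> [[e [y [ye fullE]]]|[e [y [z [yF zF ye ze]]]]].
  have yB : y \in B.
    by apply: (subsetP (sub_heavy #|A|.+1 B f)); rewrite fullE set11.
  have [z zB ze] := separated_partner yB ye.
  by exists e, y, z; split=> //; apply: has_room_full1.
have sFB := sub_heavy #|A|.+1 B f; exists e, y, z; split=> //.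
- exact: subsetP sFB y yF.
- exact: subsetP (setSD _ sFB) z zF.
- exact: has_room_full2.
Qed.

(* If no demand joins two saturated vertices, counting the demands at these   *)
(* vertices shows that there is room to spare.                                *)
Lemma servable_saturated :
  full B f = set0 -> saturated B f != set0 -> servable f.
Proof.
move=> no_full /set0Pn[h hS]; have sSB := sub_heavy #|A| B f.
have roomE y z : has_room (B :\ y :\ z) f =
    (deg f a + #|saturated B f :\ y :\ z| <= #|B :\ y :\ z|).
  by rewrite /has_room !heavyD1 no_full !set0D cards0 addn0.
have [/existsP[e]|no_saturated_pair] :=
    boolP [exists e, 1 < #|saturated B f :&: f e|].
  case/card_gt1P=> y [z []] /setIP[yS ye] /setIP[zS ze] yz.
  have zSy : z \in saturated B f :\ y by rewrite in_setD1 eq_sym yz.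
  have [yB zB] := (subsetP sSB y yS, subsetP (setSD [set y] sSB) z zSy).
  exists e, y, z; split; rewrite // roomE; move: room.
  rewrite /has_room no_full cards0 (cardsD2 yS zSy) (cardsD2 yB zB).
  by nat_lia.
have saturated_le1 e : #|saturated B f :&: f e| <= 1.
  rewrite leqNgt; apply: contra no_saturated_pair => saturated_e.
  by apply/existsP; exists e.
have saturated_le := heavy_touching saturated_le1.
rewrite no_full cards0 in saturated_le.
have touch_le := no_direct_heavy #|A| (separated_no_direct sep).
have hB := subsetP sSB h hS.
have [e he] : exists e, h \in f e.
  by apply/deg_gt0P; move: hS; rewrite inE => /andP[_]; nat_lia.
have [z zB ze] := separated_partner hB he.
exists e, h, z; split; rewrite // roomE.
have cardS := cardsD1_mem hS; have cardB := cardsD2 hB zB.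
have : #|saturated B f| + #|A| <= #|A| * #|saturated B f| + 1.
  by move: A_gt1 cardS; clear; nia.
by have := subset_leq_card (subD1set (saturated B f :\ h) z); nat_lia.
Qed.

(* As a has minimal degree in its side, averaging bounds its degree.          *)
Lemma servable_light e : {in A, forall x, deg f a <= deg f x} ->
  f e != set0 -> f e \subset B -> saturated B f = set0 -> servable f.
Proof.
move=> deg_min fe eB no_saturated.
have no_full : full B f = set0.
  by apply/eqP; rewrite -subset0 -no_saturated sub_heavyS.
have [y ye] := set0Pn _ fe; have yB := subsetP eB y ye.
have [z zB ze] := separated_partner yB ye; exists e, y, z; split=> //.
rewrite /has_room !heavyD1 no_saturated no_full !set0D cards0 !addn0.
have touch_lt : #|touching f (a |: A)| < load f.
  apply/proper_card/properP; split; first exact: touching_demands.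
  exists e; rewrite inE // negbK disjoint_sym.
  exact: disjointWr eB hub_disjoint.
have sum_ge : deg f a * #|A|.+1 <= \sum_(x in a |: A) deg f x.
  have <- : #|a |: A| = #|A|.+1 by rewrite cardsU1 aA.
  rewrite mulnC -sum_nat_const; apply: leq_sum => x.
  by case/setU1P => [->|/deg_min].
have sum_le := sum_deg_touching (fun d => demands_in_cardI (a |: A) d fS).
have deg_sum : deg f a * #|A|.+1 + 6 <= 2 * (#|A| + #|B|) by nat_lia.
have : #|B| = #|A| \/ #|B| = #|A|.+1 by nat_lia.
have := cardsD2 yB zB; move: A_gt1 deg_sum; clear.
by move: #|B :\ y :\ z| (deg f a) #|A| #|B| => r d p q; nia.
Qed.

Lemma has_room_servable e : {in A, forall x, deg f a <= deg f x} ->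
  f e != set0 -> f e \subset B -> servable f.
Proof.
move=> deg_min fe eB; have [no_full|] := eqVneq (full B f) set0; last first.
  exact: servable_full.
have [|] := eqVneq (saturated B f) set0; last exact: servable_saturated.
exact: servable_light deg_min fe eB.
Qed.

End Servable.

(** * Reduction to the graph without the removed vertex *)

Section Smaller.

Hypothesis smaller : pairable E A B.

Lemma hub_light R f : hub_fits R f -> {in R, forall y, deg f y <= #|A|} ->
    deg f a + #|saturated R f| <= #|R| -> load f + 3 <= #|A| + #|B| ->
  routable (hub R) f.
Proof.
move=> [sRB fS fA fB] fR deg_a loadf; set L := [set y in R | deg f y < #|A|].
have sLR : L \subset R by apply/subsetP => y; rewrite inE => /andP[].
have deg_aL : deg f a <= #|L|.
  by have := card_heavy_light #|A| R f; rewrite -/L; nat_lia.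
have [f' [[_ _ deg_le load_le] fAB back]] :=
  hub_send_all (subset_trans sLR sRB) fS deg_aL.
apply: (sub_routable (sub_hub sLR)); apply/back/smaller; last by nat_lia.
split=> // [x xA|y yB]; apply: leq_trans (deg_le _) _.
  have -> : x \in L = false; last by rewrite addn0 fA.
  by apply: contraFF (disjointFr dAB xA) => /(subsetP sLR)/(subsetP sRB).
rewrite inE; have [yR|yR] := boolP (y \in R); last first.
  by have := fB y yB; rewrite (negbTE yR) !addn0.
by have := fR y yR; case: ltnP => /=; nat_lia.
Qed.

Lemma hub_balanced R f : balanced R f -> load f + 3 <= #|A| + #|B| ->
  load f < #|A|.+1.*2 -> routable (hub R) f.
Proof.
have [n] := ubnP #|R|; elim: n R f => // n IHn R f cardR bal loadf load_lt.
have [hubf nodir room] := bal.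
have [no_full|/(full_relief room load_lt)] := eqVneq (full R f) set0.
  apply: hub_light => //; last by move: room; rewrite /has_room; nat_lia.
  move=> y yR; rewrite leqNgt; apply/negP => deg_y.
  by have := in_set0 y; rewrite -no_full inE yR deg_y.
case=> e [y [z [yR zR ye relief room']]]; have cardR' := cardsD2 yR zR.
have [bal' load' back] := balanced_lift hubf nodir room' yR zR ye relief.
by apply/back/IHn => //; nat_lia.
Qed.

Lemma hub_serve f : #|B| <= #|A|.+1 -> hub_fits B f -> no_direct B f ->
    load f + 2 <= #|A| + #|B| -> servable f ->
  routable (hub B) f.
Proof.
move=> leBA hubf nodir loadf [e [y [z [yB zB ye ze room]]]].
have [bal load' back] := balanced_lift hubf nodir room yB zB ye (or_introl ze).
by rewrite ze in load'; apply/back/hub_balanced => //; nat_lia.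
Qed.

Lemma hub_reduce R f : 1 < #|A| -> #|B| <= #|A|.+1 -> hub_fits R f ->
    deg f a <= #|R| -> load f + 2 <= #|A| + #|R| -> load f + 3 <= #|A| + #|B| ->
  routable (hub R) f.
Proof.
move=> A_gt1 leBA; have [n] := ubnP #|R|.
elim: n R f => // n IHn R f cardR hubf deg_a loadR loadf.
have [/existsP[e /andP[ae /pred0Pn[b /andP[/= be bR]]]]|] :=
  boolP [exists e, (a \in f e) && ~~ [disjoint f e & R]].
  have [hubf' deg_a' load' back] := hub_send_direct hubf bR ae be.
  have cardR' := cardsD1_mem bR.
  by apply: back; apply: IHn => //; nat_lia.
rewrite negb_exists => /forallP none_direct.
have nodir : no_direct R f.
  by move=> e ae; have := none_direct e; rewrite ae /= negbK.
have [sRB _ _ _] := hubf; have cardR' := subset_leq_card sRB.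
by apply: hub_balanced; [split=> //; exact: no_direct_has_room | | nat_lia].
Qed.

Lemma hub_two_direct f d e y z :
    0 < #|A| -> #|B| <= #|A|.+1 -> demands_in (a |: (A :|: B)) f ->
    {in a |: A, forall x, deg f x <= #|B|} -> {in B, forall y, deg f y <= 1} ->
    d != e -> f d = [set a; y] -> f e = [set a; z] -> y \in B -> z \in B ->
    load f < #|A| + #|B| ->
  routable (hub B) f.
Proof.
move=> A_gt0 leBA fS fA fB de fdE feE yB zB loadf.
have [ad yd] : a \in f d /\ y \in f d by rewrite fdE set21 set22.
have [ae ze] : a \in f e /\ z \in f e by rewrite feE set21 set22.
have yz : y != z.
  apply: contra de => /eqP yz.
  by apply/eqP/(card_le1_eqP (fB y yB)); rewrite inE // yz.
have zBy : z \in B :\ y by rewrite in_setD1 eq_sym yz.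
have hubf : hub_fits B f.
  split=> // [x xA|b bB]; first by apply: fA; rewrite inE xA orbT.
  by rewrite bB; have := fB b bB; nat_lia.
have [hubf1 deg_a1 load1 back1] := hub_send_direct hubf yB ad yd.
have fe1 : reroute f d a y e = f e by rewrite reroute_neq // eq_sym.
rewrite -fe1 in ae ze.
have [hubf2 deg_a2 load2 back2] := hub_send_direct hubf1 zBy ae ze.
set f2 := reroute _ e a z in hubf2 deg_a2 load2 back2.
have cardB := cardsD2 yB zBy.
have deg_f2 : {in B :\ y :\ z, forall x, deg f2 x <= 1}.
  move=> x; rewrite !in_setD1 => /and3P[xz xy xB]; have ax := hub_neq xB.
  by rewrite !deg_reroute_neq ?fB // eq_sym.
apply/back1/back2/hub_light => // [x xB||]; last by nat_lia.
  exact: leq_trans (deg_f2 x xB) A_gt0.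
have -> : saturated (B :\ y :\ z) f2 = set0; last first.
  by have := fA a (setU11 _ _); rewrite cards0; nat_lia.
apply/eqP; rewrite -[_ == _]negbK; apply/set0Pn => -[x].
rewrite inE => /andP[xB deg_x]; have := deg_f2 x xB.
have : 0 < #|B :\ y :\ z| by apply/card_gt0P; exists x.
by nat_lia.
Qed.

End Smaller.

End Hub.

(** * Removing a vertex *)

Section Removal.

Variables (V E : finType) (A B : {set V}).
Hypothesis dAB : [disjoint A & B].
Implicit Types (f : E -> {set V}) (e : E) (a b : V).

Lemma routable_hub a f :
  a \in A -> routable (hub (A :\ a) B a B) f -> routable (bip A B) f.
Proof. by move=> aA; apply: sub_routable => x y; rewrite hub_bip setD1K. Qed.

Lemma fits_hub a f : a \in A -> fits A B f ->
  hub_fits (A :\ a) B a B f /\ deg f a <= #|B|.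
Proof.
move=> aA [fAB fA fB]; split; last exact: fA.
split=> // [|x /setD1P[_ /fA]//|y yB]; first by rewrite setUA setD1K.
by have := fB y yB; rewrite yB (cardsD1_mem aA) addn1.
Qed.

Hypotheses (A_gt2 : 2 < #|A|) (leBA : #|B| <= #|A|).

Lemma remove_slack a f : a \in A -> pairable E (A :\ a) B -> fits A B f ->
  load f + 4 <= #|A| + #|B| -> routable (bip A B) f.
Proof.
move=> aA smaller fitsf loadf; have [hubf deg_a] := fits_hub aA fitsf.
have [aA' aB] := (negbT (setD11 a A), negbT (disjointFr dAB aA)).
have cardA := cardsD1_mem aA; apply: (routable_hub aA).
by apply: (hub_reduce aA' aB (disjointD1 a dAB) smaller _ _ hubf); nat_lia.
Qed.

Hypothesis smaller : {in A, forall a, pairable E (A :\ a) B}.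

Lemma remove_direct a b e f : fits A B f -> load f + 3 <= #|A| + #|B| ->
    a \in A -> b \in B -> a \in f e -> b \in f e ->
  routable (bip A B) f.
Proof.
move=> fitsf loadf aA bB ae be; have [hubf deg_a] := fits_hub aA fitsf.
have [aA' aB] := (negbT (setD11 a A), negbT (disjointFr dAB aA)).
have dAB' := disjointD1 a dAB.
have [hubf' deg_a' load' back] := hub_send_direct aA' aB dAB' hubf bB ae be.
have [cardA cardB] := (cardsD1_mem aA, cardsD1_mem bB).
apply/(routable_hub aA)/back.
by apply: (hub_reduce aA' aB dAB' (smaller aA) _ _ hubf'); nat_lia.
Qed.

Lemma remove_inside e f : fits A B f -> load f + 3 <= #|A| + #|B| ->
    #|A| <= #|B|.+1 -> separated A B f -> f e != set0 -> f e \subset B ->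
  routable (bip A B) f.
Proof.
move=> fitsf loadf leAB sep fe eB.
have [a aA deg_min] : exists2 a, a \in A & {in A, forall x, deg f a <= deg f x}.
  have /card_gt0P[x xA] : 0 < #|A| by nat_lia.
  by case: (arg_minnP (deg f) xA) => a; exists a.
have [hubf deg_a] := fits_hub aA fitsf; have [_ fS _ _] := hubf.
have [aA' aB] := (negbT (setD11 a A), negbT (disjointFr dAB aA)).
have dAB' := disjointD1 a dAB; have cardA := cardsD1_mem aA.
have sep' : separated (a |: A :\ a) B f by rewrite setD1K.
have nodir := separated_no_direct aB dAB' sep'.
have room : has_room (A :\ a) a B f.
  by apply: no_direct_has_room hubf nodir _ _ _; nat_lia.
apply: (routable_hub aA).
apply: (hub_serve aA' aB dAB' (smaller aA) _ hubf nodir); try nat_lia.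
apply: (has_room_servable aA' aB dAB' fS sep' _ _ _ _ room _ fe eB);
  try nat_lia.
by move=> x /setD1P[_]; apply: deg_min.
Qed.

End Removal.

(** * Simple families of demands *)

Section Simple.

Variables (V E : finType) (S : {set V}) (f : E -> {set V}).
Hypotheses (fS : demands_in S f) (simple_f : {in demands f &, injective f}).
Implicit Types (d e : E) (u x y z : V) (X : {set V}) (F : {set E}).

Lemma simple_avoid u X : u \notin X -> #|X| < deg f u ->
  exists2 e, u \in f e & [disjoint f e & X].
Proof.
move=> uX dX; have [/existsP[e /andP[]]|none] :=
  boolP [exists e, (u \in f e) && [disjoint f e & X]]; first by exists e.
suff : deg f u <= #|X| by rewrite leqNgt dX.
rewrite /deg -(card_in_imset (f := f) (D := demands_at f u)); last first.
  move=> d e; rewrite !inE => ud ue.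
  by apply: simple_f; rewrite inE; apply: mem_nonempty; [exact: ud | exact: ue].
apply: leq_trans (leq_imset_card (fun x => [set u; x]) X).
apply/subset_leq_card/subsetP => Y /imsetP[e]; rewrite inE => ue ->.
have [x [ux fe _ _]] := demands_in_pair fS ue; rewrite fe; apply: imset_f.
apply: contraR none => xX; apply/existsP; exists e.
rewrite ue disjoints_subset fe.
by rewrite subUset !sub1set !inE uX xX.
Qed.

Lemma disjoint_demand x y e : f e = [set x; y] -> deg f x + deg f y <= load f ->
  exists2 d, d \in demands f & [disjoint f d & f e].
Proof.
move=> fe deg_xy.
have /card_gt0P[d] : 0 < #|demands f :\: touching f (f e)|.
  have := cardsID (touching f (f e)) (demands f).
  rewrite (setIidPr (touching_demands f (f e))) -/(load f).
  have : touching f (f e) \subset demands_at f x :|: demands_at f y.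
    apply/subsetP => d; rewrite !inE => /pred0Pn[z /andP[/= zd]].
    by rewrite fe => /set2P[<-|<-]; rewrite zd ?orbT.
  move/subset_leq_card; have := cardsUI (demands_at f x) (demands_at f y).
  have : 0 < #|demands_at f x :&: demands_at f y|.
    by apply/card_gt0P; exists e; rewrite !inE fe set21 set22.
  by move: deg_xy; rewrite /deg; nat_lia.
by rewrite !inE negbK => /andP[dis fd]; exists d; rewrite ?inE.
Qed.

Variable q : nat.
Hypotheses (q_gt2 : 2 < q) (loadf : load f + 2 = 2 * q).
Hypothesis deg_le : forall x, deg f x <= q.

Lemma card_full : #|[set x | deg f x == q]| <= 3.
Proof.
set T := [set x | _].
have sum_ge : q * #|T| <= \sum_(x in T) deg f x.
  by rewrite mulnC -sum_nat_const; apply: leq_sum => x; rewrite inE => /eqP->.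
have sum_le := sum_deg_touching (fun e => demands_in_cardI T e fS).
have touch_le := subset_leq_card (touching_demands f T).
rewrite -/(load f) in touch_le.
have : q * #|T| < q * 4 by nat_lia.
by rewrite ltn_mul2l => /andP[].
Qed.

Lemma full_covering_demand x : deg f x = q -> exists2 e, f e != set0 &
  x \notin f e /\ (forall y, deg f y = q -> y != x -> y \in f e).
Proof.
move=> deg_x; pose T := [set y | deg f y == q] :\ x.
have cardT : #|T| <= 2.
  have xfull : x \in [set y | deg f y == q] by rewrite inE deg_x.
  by have := card_full; rewrite (cardsD1_mem xfull).
have inT y : deg f y = q -> y != x -> y \in T.
  by rewrite !inE => -> ->; rewrite eqxx.
have Tdeg y : y \in T -> deg f y = q /\ x != y.
  by rewrite !inE => /andP[yx /eqP->]; rewrite eq_sym.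
case card_eq: #|T| cardT => [|[|[|//]]] _.
- have /card_gt0P[e] : 0 < #|demands f :\: demands_at f x|.
    have := cardsID (demands_at f x) (demands f); rewrite -/(load f).
    have := subset_leq_card (subsetIr (demands f) (demands_at f x)).
    by rewrite -/(deg f x) deg_x; nat_lia.
  rewrite !inE => /andP[xe fe]; exists e => //; split=> // y deg_y yx.
  by have := inT y deg_y yx; rewrite (cards0_eq card_eq) inE.
- have /cards1P[y TE] : #|T| == 1 by rewrite card_eq.
  have [|deg_y xy] := Tdeg y; first by rewrite TE set11.
  have yx : y \notin [set x] by rewrite inE eq_sym.
  have [|e ye] := simple_avoid yx; first by rewrite cards1 deg_y; nat_lia.
  rewrite disjoint_sym disjoints1 => xe; exists e; first exact: mem_nonempty ye.
  by split=> // z deg_z zx; have := inT z deg_z zx; rewrite TE inE => /eqP->.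
have /cards2P[y [z [yz TE]]] : #|T| == 2 by rewrite card_eq.
have [|deg_y xy] := Tdeg y; first by rewrite TE set21.
have [|deg_z xz] := Tdeg z; first by rewrite TE set22.
have [e ye ze] : exists2 e, y \in f e & z \in f e.
  by apply: common_demand; nat_lia.
exists e; first exact: mem_nonempty ye.
have [t [yt fe _ _]] := demands_in_pair fS ye.
have zt : z = t by move: ze; rewrite fe => /set2P[zy|//]; rewrite zy eqxx in yz.
split=> [|v deg_v vx]; first by rewrite fe -zt !inE negb_or xy.
by have := inT v deg_v vx; rewrite TE fe -zt.
Qed.

Lemma disjoint_covering_demands : exists d e, [/\ f d != set0, f e != set0,
  [disjoint f d & f e] & forall x, deg f x = q -> x \in f d :|: f e].
Proof.
have [/existsP[x /eqP deg_x]|none_full] := boolP [exists x, deg f x == q].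
  have [e fe [xe cov]] := full_covering_demand deg_x.
  have [|d xd dis] := simple_avoid xe.
    by have := demands_in_card e fS; rewrite deg_x; nat_lia.
  exists d, e; split=> [|//|//|y deg_y]; first exact: mem_nonempty xd.
  rewrite inE; have [->|yx] := eqVneq y x; first by rewrite xd.
  by rewrite (cov y deg_y yx) orbT.
have deg_lt x : deg f x < q.
  rewrite ltn_neqAle deg_le andbT.
  by apply: contra none_full => deg_x; apply/existsP; exists x.
have /card_gt0P[e] : 0 < load f by nat_lia.
rewrite inE => fe; have [x xe] := set0Pn _ fe.
have [y [xy feE _ _]] := demands_in_pair fS xe.
have [|d] := disjoint_demand feE.
  by have := deg_lt x; have := deg_lt y; nat_lia.
rewrite inE => fd dis; exists d, e; split=> // z deg_z.
by have := deg_lt z; rewrite deg_z ltnn.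
Qed.

Lemma full_covering_matching : exists F, [/\ matching f F, #|F| = 2
  & forall x, deg f x = q -> exists2 e, e \in F & x \in f e].
Proof.
have [d [e [fd fe dis cov]]] := disjoint_covering_demands.
have de : d != e.
  by apply: contraNneq fd => de; move: dis; rewrite de -setI_eq0 setIid.
exists [set d; e]; split; first split.
- by move=> c c' /set2P[]-> /set2P[]->; rewrite ?eqxx // disjoint_sym.
- by rewrite subUset !sub1set !inE fd.
- by rewrite cards2 de.
move=> x /cov/setUP[xd|xe]; first by exists d; rewrite ?set21.
by exists e; rewrite ?set22.
Qed.

End Simple.

(** * All demands inside one side *)

Section Induction.

Variables V E : finType.
Implicit Types (A B : {set V}) (f : E -> {set V}) (F : {set E}).
Implicit Types (d e : E) (a b x : V).

Definition smaller_pairable A B := forall A' B', A' \subset A -> B' \subset B ->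
  #|A'| + #|B'| < #|A| + #|B| -> #|A'| <= #|B'|.+1 -> #|B'| <= #|A'|.+1 ->
  pairable E A' B'.

Lemma smaller_pairableC A B : smaller_pairable A B -> smaller_pairable B A.
Proof.
move=> smaller B' A' sB sA lt_card leBA leAB; apply/pairableC/smaller => //.
by rewrite addnC [#|A| + _]addnC.
Qed.

(* All demands of a matching in A are met through the same vertex of B.       *)
Lemma routable_matching A B f b F : [disjoint A & B] -> demands_in A f ->
    b \in B -> matching f F ->
  routable (bip A (B :\ b)) (meet F f) -> routable (bip A B) f.
Proof.
move=> dAB fA bB matchF met; have bA : b \notin A by rewrite (disjointFl dAB).
have bB' : b \notin B :\ b by rewrite setD11.
apply: routable_bipC; apply: (routable_hub bB).
apply: (hub_matching bB' bA fA (subxx A) matchF); last exact: routable_bipC.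
by move=> e _; apply: demands_in_subset.
Qed.

Lemma routable_one_sided A B f : [disjoint A & B] -> demands_in A f ->
  0 < #|A| -> 0 < #|B| -> load f <= #|B| -> routable (bip A B) f.
Proof.
move=> dAB fA A_gt0; have [n] := ubnP (load f).
elim: n B f dAB fA => // n IHn B f dAB fA load_lt B_gt0 load_leB.
have [/card_gt0P[a aA] /card_gt0P[b bB]] := (A_gt0, B_gt0).
have [load_le1|load_gt1] := leqP (load f) 1.
  apply: (routable_load_le1 aA bB) => //.
  by apply: demands_in_sub fA; apply: subsetUl.
have /card_gt0P[e fe] : 0 < load f by nat_lia.
apply: (routable_matching dAB fA bB (matching1 fe)).
have load_met := load_meet [set e] f.
rewrite (setIidPl _) ?sub1set // cards1 in load_met.
have cardB := cardsD1_mem bB.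
apply: IHn; try nat_lia; last exact: demands_in_meet.
exact: disjointWr (subD1set _ _) dAB.
Qed.

Section Tight.

Variables (A B : {set V}) (f : E -> {set V}).
Hypotheses (dAB : [disjoint A & B]) (fA : demands_in A f).
Hypotheses (deg_leB : forall x, deg f x <= #|B|) (cardA : #|A| = #|B|.+1).
Hypotheses (loadf : load f + 3 = #|A| + #|B|) (smaller : smaller_pairable A B).

Lemma tight_simple :
  2 < #|B| -> {in demands f &, injective f} -> routable (bip A B) f.
Proof.
move=> B_gt2 simple_f.
have load_eq : load f + 2 = 2 * #|B| by nat_lia.
have [F [matchF cardF covF]] :=
  full_covering_matching fA simple_f B_gt2 load_eq deg_leB.
have [_ subF] := matchF; have load_met := load_meet F f.
rewrite (setIidPl subF) cardF in load_met.
have /card_gt0P[b bB] : 0 < #|B| by nat_lia.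
have /card_gt0P[x xA] : 0 < #|A| by nat_lia.
have [cardB cardAx] := (cardsD1_mem bB, cardsD1_mem xA).
apply: (routable_matching dAB fA bB matchF).
apply: (remove_slack (disjointWr (subD1set _ _) dAB) _ _ xA); try nat_lia.
  by apply: smaller; rewrite ?subD1set //; nat_lia.
have metA : demands_in A (meet F f) := demands_in_meet fA; split.
- by apply: demands_in_sub metA; apply: subsetUl.
- move=> y yA; have := deg_meet F f y; have := deg_leB y.
  have [deg_y|] := eqVneq (deg f y) #|B|; last by nat_lia.
  have [e eF ye] := covF y deg_y; have : 0 < #|F :&: demands_at f y|.
    by apply/card_gt0P; exists e; rewrite !inE eF.
  by nat_lia.
- by move=> y /setD1P[_ yB]; rewrite (demands_in_deg0 metA) // (disjointFl dAB).
Qed.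

(* After the first of the common ends has been removed, both demands join the *)
(* second one to B, where all degrees are at most 1.                          *)
Lemma tight_parallel d e :
  2 < #|B| -> d != e -> f d = f e -> f d != set0 -> routable (bip A B) f.
Proof.
move=> B_gt2 de fde fd; have [u ud] := set0Pn _ fd.
have [v [uv fdE uA vA]] := demands_in_pair fA ud.
have uB : u \notin B by rewrite (disjointFr dAB).
have vA' : v \in A :\ u by rewrite in_setD1 eq_sym uv.
have dA'B := disjointD1 u dAB; have cardAB := cardsD2 uA vA'.
have fS : demands_in (u |: (A :\ u :|: B)) f.
  by apply: demands_in_sub fA; rewrite setUA setD1K // subsetUl.
have uA' : u \notin A :\ u by rewrite setD11.
have [f' [[_ at_u deg_le load_le] f'S back]] :=
  hub_send_all uA' uB (subxx B) fS (deg_leB u).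
apply: (routable_hub uA); apply: back; apply: (routable_hub vA').
have sent c : u \in f c -> f c = f d -> exists2 b, b \in B & f' c = [set v; b].
  move=> uc fc; have [b bB ->] := at_u c uc; exists b => //.
  have vb : v != b by apply: (disjoint_neq dAB).
  have ub : u != b by apply: (disjoint_neq dAB).
  by rewrite fc fdE move_end_pair // eq_sym (negbTE vb) setUC.
have ue : u \in f e by rewrite -fde.
have [[y yB f'd] [z zB f'e]] := (sent d ud erefl, sent e ue (esym fde)).
have vB : v \notin B by rewrite (disjointFr dAB).
apply: (hub_two_direct _ vB (disjointD1 v dA'B) _ _ _ _ _ _ de f'd f'e yB zB);
  rewrite ?setD11 //; try nat_lia.
- by apply: smaller; rewrite ?subxx ?subD2set //; nat_lia.
- by rewrite setUA setD1K.
- rewrite setD1K // => x /setD1P[_ xA]; apply: leq_trans (deg_le x) _.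
  by rewrite (disjointFr dAB) // addn0.
- move=> b bB; apply: leq_trans (deg_le b) _.
  by rewrite bB (demands_in_deg0 fA) // (disjointFl dAB).
Qed.

Lemma routable_tight : 0 < #|B| -> routable (bip A B) f.
Proof.
move=> B_gt0; have [B_gt2|B_le2] := leqP 3 #|B|; last first.
  by apply: routable_one_sided => //; nat_lia.
have [/existsP[d /existsP[e /and3P[de fd /eqP fde]]]|simple_f] :=
    boolP [exists d, exists e, [&& d != e, f d != set0 & f d == f e]].
  exact: (tight_parallel B_gt2 de).
apply: tight_simple => // d e; rewrite !inE => fd fe fde; apply/eqP.
apply: contraNT simple_f => de.
apply/existsP; exists d; apply/existsP; exists e.
by rewrite de fd fde eqxx.
Qed.

End Tight.

(** * Induction on the number of vertices *)

Section Step.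

Variables (A B : {set V}).
Hypotheses (dAB : [disjoint A & B]).
Hypotheses (leBA : #|B| <= #|A|) (leAB : #|A| <= #|B|.+1).
Hypothesis smaller : smaller_pairable A B.

Lemma smaller_pairableD1 : {in A, forall a, pairable E (A :\ a) B}.
Proof.
move=> a aA; have cardA := cardsD1_mem aA.
by apply: smaller; rewrite ?subD1set //; nat_lia.
Qed.

Lemma smaller_pairableD1r :
  #|A| = #|B| -> {in B, forall b, pairable E (B :\ b) A}.
Proof.
move=> cardAB b bB; have cardB := cardsD1_mem bB.
by apply/pairableC/smaller; rewrite ?subD1set //; nat_lia.
Qed.

Lemma pairable_step : pairable E A B.
Proof.
move=> f fitsf loadf; have [fAB degA degB] := fitsf.
have [load_le1|load_gt1] := leqP (load f) 1.
  have /card_gt0P[a aA] : 0 < #|A| by nat_lia.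
  have /card_gt0P[b bB] : 0 < #|B| by nat_lia.
  exact: (routable_load_le1 aA bB).
have A_gt2 : 2 < #|A| by nat_lia.
have [sep|[e [a [b [aA bB ae be]]]]] := separatedVdirect fAB; last first.
  by apply: (remove_direct dAB _ _ smaller_pairableD1 fitsf loadf aA bB ae be).
have [/existsP[e /andP[fe eB]]|none_in_B] :=
    boolP [exists e, (f e != set0) && (f e \subset B)].
  by apply: (remove_inside dAB _ _ smaller_pairableD1 fitsf _ _ sep fe eB).
have fA : demands_in A f.
  move=> e fe; split; first by case: (fAB e fe).
  by case/orP: (sep e) => // eB; case/existsP: none_in_B; exists e; rewrite fe.
have [cardAB|cardAB] : #|A| = #|B| \/ #|A| = #|B|.+1 by nat_lia.
  have /card_gt0P[e] : 0 < load f by nat_lia.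
  rewrite inE => fe; have [_ eA] := fA e fe.
  have dBA : [disjoint B & A] by rewrite disjoint_sym.
  have smallerBA := smaller_pairableD1r cardAB; apply: routable_bipC.
  have [fitsBA sepBA] := (fitsC fitsf, separatedC sep).
  by apply: (remove_inside dBA _ _ smallerBA fitsBA _ _ sepBA fe eA); nat_lia.
have [slack|tight] := leqP (load f + 4) (#|A| + #|B|).
  have /card_gt0P[a aA] : 0 < #|A| by nat_lia.
  by apply: (remove_slack dAB _ _ aA (smaller_pairableD1 aA)).
apply: routable_tight => //; try nat_lia.
move=> x; have [/degA//|xA] := boolP (x \in A).
by rewrite (demands_in_deg0 fA).
Qed.

End Step.

Theorem pairable_near_balanced A B : [disjoint A & B] ->
  #|A| <= #|B|.+1 -> #|B| <= #|A|.+1 -> pairable E A B.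
Proof.
have [n] := ubnP (#|A| + #|B|).
elim: n A B => // n IHn A B card_lt dAB leAB leBA.
have smaller : smaller_pairable A B.
  move=> A' B' sA sB lt_card; apply: IHn; first by nat_lia.
  exact: disjointWl sA (disjointWr sB dAB).
have [le_card|/ltnW le_card] := leqP #|B| #|A|; first exact: pairable_step.
apply/pairableC/pairable_step => //; first by rewrite disjoint_sym.
exact: smaller_pairableC.
Qed.

End Induction.

Definition left_side n : {set 'I_n + 'I_n} := [set inl i | i : 'I_n].

Lemma card_left_side n : #|left_side n| = n.
Proof. by rewrite card_imset ?card_ord // => i j []. Qed.

Lemma card_left_sideC n : #|~: left_side n| = n.
Proof. by rewrite cardsCs setCK card_sum card_ord card_left_side addnK. Qed.

Lemma bip_left_side n : bip (left_side n) (~: left_side n) =2 Knn n.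
Proof.
have inl_left i : inl i \in left_side n by apply: imset_f.
have inr_left i : inr i \in left_side n = false by apply/negP => /imsetP[].
by move=> [i|i] [j|j]; rewrite /bip !inE ?inl_left ?inr_left.
Qed.

Theorem theorem3 (n : nat) (D : multigraph ('I_n + 'I_n)%type) :
  2 <= n -> #|edge D| <= 2 * n - 3 -> max_degree D <= n ->
  realizable (Knn n) D.
Proof.
move=> n_ge2 cardE deg_le.
have [cardA cardB] := (card_left_side n, card_left_sideC n).
have deg_n v : deg (@ends _ D) v <= n.
  by apply: leq_trans deg_le; apply: (leq_bigmax (F := degree D)).
have load_le : load (@ends _ D) <= #|edge D| by apply: max_card.
apply: realizable_of_routable.
apply: (@sub_routable _ _ (bip (left_side n) (~: left_side n))).
  by move=> x y; rewrite bip_left_side.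
apply: pairable_near_balanced; rewrite ?cardA ?cardB //; last by nat_lia.
- by rewrite disjoints_subset setCK.
- split=> [e _|x _|x _]; rewrite ?cardA ?cardB //.
  by rewrite edge_ends setUCr subsetT.
Qed.
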